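(* Let $(\Omega,\rho)$ be a compact metric ring containing the set $\mathbb{N}$ of positive integers as a dense subset. Let $\mathcal{A}=\{g(n): n\in\mathbb{N}\}$, where $g(n)$ is the smallest positive integer generating the principal ideal $n\Omega$. Write $\mathcal{A}=\{m_n : n=1,2,\dots\}$, put $M_n=[m_1,\dots,m_n]$ (least common multiple), and for $\alpha\in\Omega$ put $$\|\alpha\|_{\mathcal{A}}=\sum_{n=1}^\infty \frac{1-\mathcal{X}_{M_n\Omega}(\alpha)}{2^{n}} .$$ Then the metric $\rho$ is equivalent with the metric $\rho_{\mathcal{A}}$ on $\Omega$ given by $\rho_{\mathcal{A}}(\alpha,\beta)=\|\alpha-\beta\|_{\mathcal{A}}$ for $\alpha,\beta\in\Omega$ (that is, $\rho$ and $\rho_{\mathcal A}$ induce the same topology on $\Omega$).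
   Context: Compact metric ring: $(\Omega,\rho)$ is a compact metric space and $(\Omega,+,\cdot)$ is a commutative ring whose addition and multiplication are continuous. ''Containing $\mathbb{N}$ as a dense subset'' means $\mathbb{N}\subset\Omega$ is dense and the ring operations of $\Omega$ extend the usual addition and multiplication of positive integers. For $m\in\mathbb{N}$, $m\Omega=\{m\omega:\omega\in\Omega\}$ is the principal ideal generated by $m$. A positive integer $k$ generates $n\Omega$ if $k\Omega=n\Omega$; thus $g(n)=\min\{k\in\mathbb{N}: k\Omega=n\Omega\}$. $\mathcal{X}_S$ denotes the characteristic (indicator) function of a set $S$. The set $\mathcal{A}$ is infinite, and the enumeration $\{m_n\}$ of it is arbitrary. *)

(* Defs.v *)
From HB Require Import structures.
From mathcomp Require Import all_boot all_order all_algebra.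
From mathcomp Require Import all_classical all_reals all_analysis.

Set Implicit Arguments.
Unset Strict Implicit.
Unset Printing Implicit Defensive.

Import Order.TTheory GRing.Theory Num.Theory.
Import numFieldNormedType.Exports.

Local Open Scope classical_set_scope.
Local Open Scope ring_scope.

(* Two metrics on one carrier have to be compared, so metrics are first-class
   values; nonnegativity follows from the fields, as in the factory [isMetric]. *)
Record metric (R : realType) (T : Type) := Metric_ {
  dist_of :> T -> T -> R ;
  dist_ofxx : forall x, dist_of x x = 0 ;
  dist_of_positivity : forall x y, dist_of x y = 0 -> x = y ;
  dist_of_sym : forall x y, dist_of x y = dist_of y x ;
  dist_of_triangle : forall y x z, dist_of x z <= dist_of x y + dist_of y z
}.

(* [metrized d] is the carrier T seen as the metric space (T, d), so that the
   topological notions of the library apply to it. The library has a structure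
   (PseudoMetricNormedZmod) above both metric spaces and additive groups, which
   rules out adding a join of metricType and comPzRingType below it. *)
Definition metrized (R : realType) (T : choiceType) (d : metric R T) : Type := T.

HB.instance Definition _ (R : realType) (T : choiceType) (d : metric R T) :=
  Choice.on (metrized d).

HB.instance Definition _ (R : realType) (T : choiceType) (d : metric R T) :=
  isMetric.Build R (metrized d) (dist_ofxx d) (@dist_of_positivity R T d)
    (dist_of_sym d) (dist_of_triangle d).

Definition equivalent_metrics (R : realType) (T : choiceType)
    (d1 d2 : metric R T) :=
  forall U : set T, @open (metrized d1) U <-> @open (metrized d2) U.

Section CompactMetricRing.
Context (R : realType) (Omega : comPzRingType) (rho : metric R Omega).

Definition addm (xy : metrized rho * metrized rho) : metrized rho :=
  (xy.1 : Omega) + (xy.2 : Omega).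

Definition mulm (xy : metrized rho * metrized rho) : metrized rho :=
  (xy.1 : Omega) * (xy.2 : Omega).

(* Opposite is x |-> (-1) * x, so its continuity need not be required. *)
Definition compact_metric_ring :=
  [/\ compact [set: metrized rho], continuous addm & continuous mulm].

Definition posnat : set nat := [set n | (0 < n)%N].

(* The copy of the positive integers in Omega is {n%:R | n > 0}: if an additive
   and multiplicative copy of them is dense, then its 1 acts as an identity on a
   dense subset, hence is the unit of Omega. *)
Definition contains_nat_densely :=
  set_inj posnat (fun n : nat => n%:R : Omega) /\
  @dense (metrized rho) [set (n%:R : Omega) | n in posnat].

End CompactMetricRing.

Section Generators.
Context (Omega : comPzRingType).

Definition principal_ideal (m : nat) : set Omega :=
  [set m%:R * w | w in [set: Omega]].

Definition generators (n : nat) : set nat :=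
  [set k | (0 < k)%N /\ principal_ideal k = principal_ideal n].

(* For n > 0 the minimum exists, as n itself belongs to [generators n]; the
   default value 0 of [xget] is not reached. *)
Definition min_generator (n : nat) : nat :=
  xget 0%N [set k | generators n k /\
                    forall j, generators n j -> (k <= j)%N].

Definition min_generators : set nat := [set min_generator n | n in posnat].

End Generators.

(* The enumeration m_1, m_2, ... is indexed from 1; m 0 is irrelevant. *)
Definition lcm_upto (m : nat -> nat) (n : nat) : nat :=
  \big[lcmn/1%N]_(1 <= i < n.+1) m i.

Definition enum_norm (R : realType) (Omega : comPzRingType)
    (m : nat -> nat) (a : Omega) : R :=
  limn (fun N : nat => \sum_(1 <= n < N.+1)
    (1 - \1_(principal_ideal (lcm_upto m n)) a) / 2 ^+ n : R).

Definition enum_dist (R : realType) (Omega : comPzRingType)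
    (m : nat -> nat) (a b : Omega) : R := enum_norm R m (a - b).

(* Main.v *)
Require Import Defs.
From HB Require Import structures.
From mathcomp Require Import all_boot all_order all_algebra.
From mathcomp Require Import all_classical all_reals all_analysis.

Set Implicit Arguments.
Unset Strict Implicit.
Unset Printing Implicit Defensive.

Import Order.TTheory GRing.Theory Num.Theory.
Import numFieldNormedType.Exports.

Local Open Scope classical_set_scope.
Local Open Scope ring_scope.

(** Both topologies are described by their neighborhoods, and in both of them
    the ideals [n Omega] with [n > 0] form a basis of neighborhoods of 0.

    For [rho] this rests on two facts. First, every neighborhood [U] of 0
    contains some [n Omega] ([nbhs0_principal_ideal_sub]): since [0 * w = 0]
    for every [w] and [Omega] is compact, some neighborhood [V] of 0 satisfies
    [V * Omega <= U], and by density [V] contains a positive integer [n]. In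
    particular the intersection of the ideals [n Omega] is 0. Second, each
    [n Omega] is a neighborhood of 0 ([nbhs0_principal_ideal]): it is compact,
    hence closed, and by density the finitely many cosets [r + n Omega],
    [r < n], cover [Omega]; a closed subgroup of finite index is open.

    For the new metric, every [n Omega] equals some [m_j Omega], which contains
    [M_j Omega], so the decreasing sequence [M_j Omega] is cofinal among the
    ideals [n Omega] ([lcm_upto_cofinal]). The series of the norm is geometric:
    the norm of a nonzero [a] is [2 ^ -j] for the last [j] such that [a] lies
    in [M_j Omega], with [M_0 = 1]. Hence small balls around 0 and small ideals
    [M_j Omega] contain one another ([dyadic_norm_le], [dyadic_norm_lt]). The
    new metric is translation invariant by definition; for [rho] the passage
    from 0 to another point uses the continuity of [w |-> x - w]. *)

(** * The norm attached to a sequence of subgroups *)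

Section DyadicNorm.
Context (R : realType) (V : zmodType) (I : nat -> set V).

Definition dyadic_sum (a : V) (N : nat) : R :=
  \sum_(1 <= n < N.+1) (1 - \1_(I n) a) / 2 ^+ n.

(** With [I n] the ideal of the lcm of [m 1], ..., [m n], this unfolds to
    [enum_norm R m]. *)
Definition dyadic_norm (a : V) : R := limn (dyadic_sum a).

Lemma dyadic_term_ge0 (a : V) (n : nat) :
  0 <= (1 - \1_(I n) a) / 2 ^+ n :> R.
Proof.
apply: divr_ge0; last exact: exprn_ge0.
rewrite subr_ge0 indicE.
by case: (a \in I n); rewrite ?ler01.
Qed.

Lemma dyadic_sumS (a : V) (N : nat) :
  dyadic_sum a N.+1 = dyadic_sum a N + (1 - \1_(I N.+1) a) / 2 ^+ N.+1.
Proof. by rewrite /dyadic_sum big_nat_recr. Qed.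

Lemma dyadic_sum_nondecreasing (a : V) : nondecreasing_seq (dyadic_sum a).
Proof.
apply/nondecreasing_seqP => N.
by rewrite dyadic_sumS lerDl dyadic_term_ge0.
Qed.

(** The terms up to [n] vanish and the others are at most those of the
    geometric series. With [n = 0] the hypothesis is void, so that this also
    bounds all partial sums by 1. *)
Lemma dyadic_sum_le (a : V) (n N : nat) :
  (forall i, (0 < i <= n)%N -> I i a) -> dyadic_sum a N <= (2 ^+ n)^-1.
Proof.
move=> Ia.
have sum0 k : (k <= n)%N -> dyadic_sum a k = 0.
  move=> kn; rewrite /dyadic_sum big_nat_cond big1// => i.
  rewrite andbT ltnS => /andP[i0 ik].
  rewrite indicE mem_set ?subrr ?mul0r//.
  by apply: Ia; rewrite i0 (leq_trans ik).
(* The subtracted term makes the bound provable by induction on [k]. *)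
have tail k : dyadic_sum a (n + k) <= (2 ^+ n)^-1 - (2 ^+ (n + k))^-1.
  elim: k => [|k IHk]; first by rewrite addn0 sum0// subrr.
  rewrite addnS dyadic_sumS.
  have -> : (2 ^+ n)^-1 - (2 ^+ (n + k).+1)^-1 =
      (2 ^+ n)^-1 - (2 ^+ (n + k))^-1 + (2 ^+ (n + k).+1)^-1 :> R.
    by rewrite exprS invfM [X in _ = _ - X + _]splitr opprD addrA mulrC subrK.
  apply: lerD => //; rewrite ler_piMl ?invr_ge0 ?exprn_ge0//.
have [/sum0 ->|/ltnW/subnKC <-] := leqP N n.
  by rewrite invr_ge0 exprn_ge0.
by apply: (le_trans (tail _)); rewrite gerBl invr_ge0 exprn_ge0.
Qed.

Lemma dyadic_sum_cvg (a : V) : cvgn (dyadic_sum a).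
Proof.
apply: nondecreasing_is_cvgn; first exact: dyadic_sum_nondecreasing.
exists (2 ^+ 0)^-1 => _ [N _ <-]; apply: dyadic_sum_le => i.
by rewrite leqn0 lt0n => /andP[/negP].
Qed.

Lemma dyadic_norm_le (a : V) (n : nat) :
  (forall i, (0 < i <= n)%N -> I i a) -> dyadic_norm a <= (2 ^+ n)^-1.
Proof.
move=> Ia; apply: limr_le; first exact: dyadic_sum_cvg.
by near=> N; apply: dyadic_sum_le.
Unshelve. all: by end_near. Qed.

(** If [a] is outside [I n], then the [n]-th term alone is [2 ^- n]. *)
Lemma dyadic_norm_lt (a : V) (n : nat) : (0 < n)%N ->
  dyadic_norm a < (2 ^+ n)^-1 -> I n a.
Proof.
case: n => // n _; apply: contraPP => nIa; apply/negP; rewrite -leNgt.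
apply: (@le_trans _ _ (dyadic_sum a n.+1)); last first.
  apply: nondecreasing_cvgn_le; last exact: dyadic_sum_cvg.
  exact: dyadic_sum_nondecreasing.
rewrite dyadic_sumS indicE memNset// subr0 mul1r lerDr.
by apply: sumr_ge0 => i _; exact: dyadic_term_ge0.
Qed.

Context (I0 : forall n, I n 0).
Context (IB : forall n a b, I n a -> I n b -> I n (a - b)).

Lemma dyadic_norm0 : dyadic_norm 0 = 0.
Proof.
rewrite /dyadic_norm (_ : dyadic_sum 0 = cst 0) ?lim_cst//.
apply/funext => N; rewrite /dyadic_sum big1// => i _.
by rewrite indicE mem_set// subrr mul0r.
Qed.

Lemma dyadic_normN (a : V) : dyadic_norm (- a) = dyadic_norm a.
Proof.
have IN n b : I n b -> I n (- b) by rewrite -sub0r; exact: IB.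
congr (limn _); apply/funext => N; apply: eq_bigr => n _.
rewrite !indicE; congr ((1 - (_ : bool)%:R) / _).
by apply/idP/idP; rewrite !inE => /IN; rewrite ?opprK.
Qed.

(** The inequality holds term by term: if [a + b] is outside a subgroup, then so
    is [a] or [b]. *)
Lemma dyadic_normD (a b : V) :
  dyadic_norm (a + b) <= dyadic_norm a + dyadic_norm b.
Proof.
rewrite /dyadic_norm -limD; [|exact: dyadic_sum_cvg..].
apply: ler_lim; first exact: dyadic_sum_cvg.
  by apply: is_cvgD; exact: dyadic_sum_cvg.
apply: nearW => N; rewrite [leRHS](_ : _ = dyadic_sum a N + dyadic_sum b N)//.
rewrite /dyadic_sum -big_split/=; apply: ler_sum => n _.
rewrite -mulrDl ler_pM2r ?invr_gt0 ?exprn_gt0// !indicE.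
have [Ia|nIa] := pselect (I n a); have [Ib|nIb] := pselect (I n b).
- rewrite !mem_set ?subrr ?addr0//.
  by rewrite -[b]opprK; apply: IB => //; rewrite -sub0r; exact: IB.
- rewrite (mem_set Ia) (memNset nIb) subrr add0r lerD2l lerN2.
  exact: ler0n.
- rewrite (memNset nIa) (mem_set Ib) subrr addr0 lerD2l lerN2.
  exact: ler0n.
- by rewrite (memNset nIa) (memNset nIb) lerD// ?subr0 ?ler01//.
Qed.

End DyadicNorm.

(** * Comparison of two metrics *)

(** Only one inclusion between the topologies is stated, so that the two
    directions of an equivalence are instances of the same lemma. *)
Lemma metrized_open_sub (R : realType) (T : choiceType) (d1 d2 : metric R T) :
  (forall x e, 0 < e ->
    exists2 e', 0 < e' & forall y, d2 x y < e' -> d1 x y < e) ->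
  forall U : set T, @open (metrized d1) U -> @open (metrized d2) U.
Proof.
move=> d12 U; rewrite !openE => oU x Ux.
have /nbhs_ballP[e /= e0 eU] := oU _ Ux.
have [e' e'0 e'e] := d12 x _ e0.
apply/nbhs_ballP; exists e' => // y xy; apply: eU.
by move: xy; rewrite !ballEmdist/=; exact: e'e.
Qed.

(** * Principal ideals generated by integers *)

Section PrincipalIdeals.
Context (Omega : comPzRingType).
Local Notation ideal := (@principal_ideal Omega).

Lemma principal_ideal0 n : ideal n 0.
Proof. by exists 0 => //; rewrite mulr0. Qed.

Lemma principal_idealB n a b : ideal n a -> ideal n b -> ideal n (a - b).
Proof. by move=> [v _ <-] [w _ <-]; exists (v - w) => //; rewrite mulrBr. Qed.

Lemma principal_ideal_nat n k : (n %| k)%N -> ideal n k%:R.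
Proof. by move=> /dvdnP[q ->]; exists q%:R => //; rewrite -natrM mulnC. Qed.

Lemma principal_ideal_dvd n k : (n %| k)%N -> ideal k `<=` ideal n.
Proof.
move=> /dvdnP[q ->] _ [w _ <-]; exists (q%:R * w) => //.
by rewrite mulrA -natrM mulnC.
Qed.

Lemma min_generatorP n : (0 < n)%N ->
  generators Omega n (min_generator Omega n).
Proof.
move=> n0; rewrite /min_generator; case: xgetP => [k -> []//|no].
have ex : exists k, `[< generators Omega n k >] by exists n; apply/asboolP.
exfalso; apply: (no (ex_minn ex)); case: ex_minnP => k /asboolP kn kmin.
by split=> // j /asboolP; exact: kmin.
Qed.

Lemma lcm_uptoS m n : lcm_upto m n.+1 = lcmn (lcm_upto m n) (m n.+1).
Proof. by rewrite /lcm_upto big_nat_recr. Qed.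

Lemma lcm_upto_gt0 m n :
  (forall i, (0 < i)%N -> (0 < m i)%N) -> (0 < lcm_upto m n)%N.
Proof.
move=> m0; elim: n => [|n IHn]; first by rewrite /lcm_upto big_geq.
by rewrite lcm_uptoS lcmn_gt0 IHn m0.
Qed.

Lemma dvdn_lcm_upto m i n : (i <= n)%N -> (lcm_upto m i %| lcm_upto m n)%N.
Proof.
elim: n => [|n IHn]; first by rewrite leqn0 => /eqP ->.
rewrite leq_eqVlt => /predU1P[->//|]; rewrite ltnS => /IHn h.
by rewrite lcm_uptoS (dvdn_trans h)// dvdn_lcml.
Qed.

(** The ideal of [n] is that of its minimal generator, which is some [m j] and
    therefore divides [lcm_upto m j]. *)
Lemma lcm_upto_cofinal m n :
  min_generators Omega = [set m i | i in posnat] -> (0 < n)%N ->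
  exists2 j, (0 < j)%N & ideal (lcm_upto m j) `<=` ideal n.
Proof.
move=> mE n0; have : min_generators Omega (min_generator Omega n) by exists n.
rewrite mE => -[[//|j] _ mj]; exists j.+1 => //.
have [_ <-] := min_generatorP n0; rewrite -mj.
by apply: principal_ideal_dvd; rewrite lcm_uptoS dvdn_lcmr.
Qed.

End PrincipalIdeals.

(** * Integral ideals as neighborhoods of zero *)

Section Topology.
Context (R : realType) (Omega : comPzRingType) (rho : metric R Omega).
Context (Omega_ring : compact_metric_ring rho).
Local Notation T := (metrized rho).
Local Notation ideal := (@principal_ideal Omega).

Lemma addl_continuous (a : Omega) :
  continuous (fun x : T => (a + (x : Omega)) : T).
Proof.
move=> x; case: Omega_ring => _ ctsD _.
have ax : (fun y : T => ((a : T), y)) y @[y --> x] --> ((a : T), x).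
  exact: (@cvg_pair T T T (nbhs x) (nbhs (a : T)) (nbhs x) _ _ _ _ _
    (cvg_cst _) cvg_id).
exact: cvg_comp ax (ctsD _).
Qed.

Lemma mull_continuous (a : Omega) :
  continuous (fun x : T => (a * (x : Omega)) : T).
Proof.
move=> x; case: Omega_ring => _ _ ctsM.
have ax : (fun y : T => ((a : T), y)) y @[y --> x] --> ((a : T), x).
  exact: (@cvg_pair T T T (nbhs x) (nbhs (a : T)) (nbhs x) _ _ _ _ _
    (cvg_cst _) cvg_id).
exact: cvg_comp ax (ctsM _).
Qed.

Lemma subl_continuous (a : Omega) :
  continuous (fun x : T => (a - (x : Omega)) : T).
Proof.
rewrite (_ : (fun x => _) = (fun x : T => (a + (x : Omega)) : T) \o
  (fun x : T => (-1 * (x : Omega)) : T)); last first.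
  by apply/funext => x /=; rewrite mulN1r.
move=> x; apply: continuous_comp; first exact: mull_continuous.
exact: addl_continuous.
Qed.

(** A continuous image of the compact space [Omega]. *)
Lemma principal_ideal_closed n : @closed T (ideal n).
Proof.
case: Omega_ring => cT _ _.
apply: compact_closed; first exact: metric_hausdorff.
apply: (@continuous_compact T T (fun x : T => (n%:R * (x : Omega)) : T)) => //.
exact/continuous_subspaceT/mull_continuous.
Qed.

Context (Omega_nat : contains_nat_densely rho).

Lemma closed_posnat_full (F : set T) :
  closed F -> (forall k, (0 < k)%N -> F (k%:R : Omega)) -> F = setT.
Proof.
move=> cF Fk; rewrite -subTset => x _; apply: contrapT => nFx.
have [v [nFv [k k0 kv]]] := Omega_nat.2 (~` F) (ex_intro _ x nFx)
  (closed_openC cF).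
by apply: nFv; rewrite -kv; exact: Fk.
Qed.

(** Compactness makes the continuity of the product at the points [(w, 0)]
    uniform in [w]; density then provides an integer close enough to 0. *)
Lemma nbhs0_principal_ideal_sub (U : set T) : nbhs ((0 : Omega) : T) U ->
  exists2 n, (0 < n)%N & ideal n `<=` U.
Proof.
case: Omega_ring => /compact_near_coveringP cT _ ctsM U0.
have : \forall v \near ((0 : Omega) : T),
    [set: T] `<=` (fun w => U (mulm (w, v))).
  apply: (cT _ (nbhs ((0 : Omega) : T)) (fun v w => U (mulm (w, v)))) => x _.
  have /ctsM : nbhs (mulm ((x : T), ((0 : Omega) : T))) U.
    by rewrite /mulm/= mulr0.
  by [].
rewrite /prop_near1 nbhsE => -[W [oW W0] WU].
have [v [/WU Uv [n n0 nv]]] := Omega_nat.2 W (ex_intro _ _ W0) oW.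
by exists n => // _ [w _ <-]; rewrite mulrC nv; exact: Uv.
Qed.

(** The union [F] of the finitely many cosets [r + n Omega] other than
    [n Omega] is closed, and together with [n Omega] it covers the integers,
    hence everything. So [n Omega] contains the complement of [F], which is
    open and contains 0. *)
Lemma nbhs0_principal_ideal n : (0 < n)%N -> nbhs ((0 : Omega) : T) (ideal n).
Proof.
move=> n0.
pose J := [set r | (r < n)%N /\ ~ ideal n r%:R].
pose F : set T := \bigcup_(r in J) [set y | ideal n (r%:R - y)].
have cF : closed F.
  apply: closed_bigcup.
    by apply: (sub_finite_set _ (finite_II n)) => r [].
  move=> r _; apply: (closed_comp (f := fun x : T => (r%:R - (x : Omega)) : T)).
    by move=> x _; exact: subl_continuous.
  exact: principal_ideal_closed.
have nF0 : (~` F) ((0 : Omega) : T) by move=> [r [_ nr]] /=; rewrite subr0.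
rewrite nbhsE; exists (~` F); first by split=> //; exact: closed_openC.
have FI : F `|` ideal n = setT.
  apply: closed_posnat_full.
    by apply: closedU => //; exact: principal_ideal_closed.
  move=> k _.
  have IB : ideal n ((k %% n)%:R - k%:R).
    rewrite {2}(divn_eq k n) natrD [X in _ - X]addrC opprD addrA subrr.
    apply: principal_idealB; first exact: principal_ideal0.
    exact/principal_ideal_nat/dvdn_mull.
  have [Ir|nIr] := pselect (ideal n (k %% n)%:R).
    right; rewrite -[k%:R](subKr (k %% n)%:R); exact: principal_idealB.
  by left; exists (k %% n)%N => //; split => //; rewrite ltn_mod.
by move=> x nFx; have [] : (F `|` ideal n) x by rewrite FI.
Qed.

End Topology.

Theorem theorem1 (R : realType) (Omega : comPzRingType) (rho : metric R Omega)
    (Omega_ring : compact_metric_ring rho)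
    (Omega_nat : contains_nat_densely rho)
    (m : nat -> nat)
    (m_enum : min_generators Omega = [set m n | n in posnat]) :
  exists2 rhoA : metric R Omega,
    (forall a b : Omega, rhoA a b = enum_dist R m a b) &
    equivalent_metrics rho rhoA.
Proof.
pose I n := @principal_ideal Omega (lcm_upto m n).
have m_gt0 i : (0 < i)%N -> (0 < m i)%N.
  move=> i0; have : [set m n | n in posnat] (m i) by exists i.
  by rewrite -m_enum => -[n n0 <-]; have [] := min_generatorP Omega n0.
have I_sub (U : set (metrized rho)) : nbhs ((0 : Omega) : metrized rho) U ->
    exists2 j, (0 < j)%N & I j `<=` U.
  move=> /(nbhs0_principal_ideal_sub Omega_ring Omega_nat)[n n0 nU].
  have [j j0 jn] := lcm_upto_cofinal m_enum n0.
  by exists j => //; exact: subset_trans nU.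
have I0 n : I n 0 by exact: principal_ideal0.
have IB n : forall a b, I n a -> I n b -> I n (a - b).
  by move=> a b; exact: principal_idealB.
pose dA a b : R := dyadic_norm R I (a - b).
have dAxx x : dA x x = 0 by rewrite /dA subrr dyadic_norm0.
(* A point at distance 0 lies in every [I j], but the complement of a nonzero
   point is a neighborhood of 0 and so contains some [I j]. *)
have dA_eq0 x y : dA x y = 0 -> x = y.
  move=> xy0; apply: contrapT => /eqP; rewrite -subr_eq0 => xy.
  have [|j j0 jU] := I_sub [set z | z != x - y].
    apply: open_nbhs_nbhs; split; last by rewrite /= eq_sym.
    rewrite (_ : mkset _ = ~` [set x - y]).
      apply: closed_openC; apply: accessible_closed_set1.
      exact/hausdorff_accessible/metric_hausdorff.
    by apply/seteqP; split=> z /= /eqP.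
  have /jU/= : I j (x - y).
    apply: (dyadic_norm_lt (R := R)) => //.
    by rewrite -/(dA x y) xy0 invr_gt0 exprn_gt0.
  by rewrite eqxx.
have dA_sym x y : dA x y = dA y x by rewrite /dA -dyadic_normN// opprB.
have dA_tri y x z : dA x z <= dA x y + dA y z.
  rewrite /dA -(subrKA y x (- z)); exact: dyadic_normD.
exists (Metric_ dAxx dA_eq0 dA_sym dA_tri) => // U.
split; apply: metrized_open_sub => x e e0.
- have [|j j0 jU] := I_sub [set w | rho x (x - w) < e].
    have /subl_continuous : nbhs (((x - 0) : Omega) : metrized rho)
        [set y | rho x y < e].
      apply/nbhs_ballP; exists e => //; rewrite subr0 => y.
      by rewrite ballEmdist.
    exact.
  exists (2 ^+ j)^-1; first by rewrite invr_gt0 exprn_gt0.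
  by move=> y /(dyadic_norm_lt j0)/jU; rewrite /mkset subKr.
- have [n ne] : exists n, (2 ^+ n)^-1 < e :> R.
    have [N _ Ne] := near_infty_natSinv_expn_lt (PosNum e0).
    by exists N; rewrite -div1r; exact: (Ne N (leqnn N)).
  have /subl_continuous : nbhs (((x - x) : Omega) : metrized rho) (I n).
    rewrite subrr; apply: nbhs0_principal_ideal => //.
    exact: lcm_upto_gt0.
  move=> /(_ Omega_ring)/nbhs_ballP[d /= d0 dI]; exists d => // y xy.
  apply: le_lt_trans ne; apply: dyadic_norm_le => i /andP[_ iN].
  apply: (principal_ideal_dvd (dvdn_lcm_upto m iN)).
  by apply: dI; rewrite ballEmdist.
Qed.
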